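(* Let $\psi:\mathbb{R}^m\to\mathbb{R}^m$ be a $\mathcal{C}^1$ mapping, $g:\mathbb{R}^m\to\overline{\mathbb{R}}$ a polyhedral function, and $S(y)=\{x\in\mathbb{R}^m\mid y\in\psi(x)+\partial g(x)\}$. Let $\bar x$ be a nondegenerate solution of $0\in\psi(x)+\partial g(x)$, i.e. $-\psi(\bar x)\in\mathrm{ri}\,\partial g(\bar x)$, and let $\bar K=K_g(\bar x,-\psi(\bar x))$. Then the conditions (a) $\nabla\psi(\bar x)\bar K+\bar K^\perp=\mathbb{R}^m$; (b) $\{w\in\mathbb{R}^m\mid\nabla\psi(\bar x)^*w\in\bar K^\perp\}\cap\bar K=\{0\}$ are equivalent, and $S$ has a Lipschitz continuous single-valued localization $\sigma$ around $0$ for $\bar x$ if and only if one of them holds. In this case $\sigma$ is $\mathcal{C}^1$ in a neighborhood of $0$ and $$\nabla\sigma(y)=B\big(B^*\nabla\psi(\sigma(y))B\big)^{-1}B^*$$ for all $y$ sufficiently close to $0$, where $B\in\mathbb{R}^{m\times s}$ is a matrix whose columns form a basis of the linear subspace $\bar K$ and $s=\dim\bar K$.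
   Context: A proper function $g:\mathbb{R}^m\to\overline{\mathbb{R}}$ is polyhedral if its epigraph is a polyhedral convex set; $\partial g$ is the convex-analysis subdifferential; $\mathrm{ri}$ is relative interior; $A^*$ is the transpose. For $z$ with $g(z)$ finite, ${\rm d} g(z)(w)=\liminf_{t\searrow 0,\,w'\to w}\frac{g(z+tw')-g(z)}{t}$ and for $\lambda\in\partial g(z)$ the critical cone is $K_g(z,\lambda)=\{w\mid\langle\lambda,w\rangle={\rm d} g(z)(w)\}$ (under the nondegeneracy assumption $\bar K$ is a linear subspace). A Lipschitz continuous single-valued localization of $S$ around $0$ for $\bar x$ means there are neighborhoods $U$ of $\bar x$ and $V$ of $0$ such that $\sigma(y):=S(y)\cap U$ is single-valued and Lipschitz continuous on $V$. *)

(* Defs.v *)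
From HB Require Import structures.
From mathcomp Require Import all_boot all_order all_algebra.
From mathcomp Require Import all_classical all_reals all_analysis.
Set Implicit Arguments. Unset Strict Implicit. Unset Printing Implicit Defensive.
Import Order.TTheory GRing.Theory Num.Theory.
Import numFieldNormedType.Exports.
Local Open Scope classical_set_scope.
Local Open Scope ring_scope.

Section defs.
Variables (R : realType) (m : nat).
Local Notation V := 'cV[R]_m.

Definition dotv (u v : V) : R := (u^T *m v) 0 0.

(* Jacobian matrix nabla f(x): entry (i,j) = d f_i / d x_j, so that
   grad f x *m w = 'd f x w. *)
Definition grad (f : V -> V) (x : V) : 'M[R]_m :=
  \matrix_(i, j) ('d f x (delta_mx j 0)) i 0.

Definition C1 (f : V -> V) : Prop :=
  (forall x, differentiable f x) /\ continuous (grad f).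

(* proper polyhedral function: proper, and its epigraph
   {(x,t) in R^m x R | g x <= t} is a finite intersection of closed half-spaces *)
Definition polyhedral_fun (g : V -> \bar R) : Prop :=
  (forall x, g x != -oo%E) /\ (exists x, g x \is a fin_num) /\
  exists n (a : 'I_n -> V) (c b : 'I_n -> R),
    forall x (t : R), (g x <= t%:E)%E <-> (forall i, dotv (a i) x + c i * t <= b i).

Definition subdiff (g : V -> \bar R) (x : V) : set V :=
  [set v | g x \is a fin_num /\ forall z, (g x + (dotv v (z - x))%:E <= g z)%E].

Definition affine_hull (C : set V) : set V :=
  [set x | exists n (c : 'I_n -> V) (l : 'I_n -> R),
     (forall i, C (c i)) /\ \sum_i l i = 1 /\ x = \sum_i l i *: c i].

Definition ri (C : set V) : set V :=
  [set x | C x /\ exists e : R, 0 < e /\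
     forall y, affine_hull C y -> `|y - x| < e -> C y].

(* subderivative  d g(z)(w) = liminf_{t \searrow 0, w' -> w} (g(z+tw') - g(z))/t *)
Definition subderiv (g : V -> \bar R) (z w : V) : \bar R :=
  ereal_sup [set ereal_inf
     [set q | exists (t : R) (w' : V), 0 < t < e /\ `|w' - w| < e /\
        q = ((g (z + t *: w')%R - g z) * (t^-1)%:E)%E] | e in [set e : R | 0 < e]].

Definition crit_cone (g : V -> \bar R) (z l : V) : set V :=
  [set w | (dotv l w)%:E = subderiv g z w].

Definition perp (K : set V) : set V := [set u | forall w, K w -> dotv u w = 0].

Definition solmap (psi : V -> V) (g : V -> \bar R) (y : V) : set V :=
  [set x | subdiff g x (y - psi x)].

Definition lip_loc (S : V -> set V) (xbar : V) (sigma : V -> V) : Prop :=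
  exists (U W : set V), nbhs xbar U /\ nbhs (0 : V) W /\
    (forall y, W y -> forall x, (U x /\ S y x) <-> x = sigma y) /\
    exists L : R, forall y1 y2, W y1 -> W y2 ->
      `|sigma y1 - sigma y2| <= L * `|y1 - y2|.

Definition cols_basis_of s (B : 'M[R]_(m, s)) (K : set V) : Prop :=
  row_free B^T /\ forall w, K w <-> exists c : 'cV[R]_s, w = B *m c.

End defs.

(* Main.v *)
Require Import Defs.
From HB Require Import structures.
From mathcomp Require Import all_boot all_order all_algebra.
From mathcomp Require Import all_classical all_reals all_analysis.
From mathcomp Require Import ring lra.
Import Order.TTheory GRing.Theory Num.Theory.
Import numFieldNormedType.Exports.
Local Open Scope classical_set_scope.
Local Open Scope ring_scope.

(** Put [lam := - psi xbar].  Writing the epigraph of [g] near [(xbar, g xbar)] as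
a polyhedral cone [a_i w + c_i s <= 0], the critical cone is
[K = {w | (a_i + c_i lam) w <= 0}].  Each active index yields a subgradient
[lam + k_i (a_i + c_i lam)] with [k_i > 0]; since [lam] is in the relative interior
one may step from [lam] in the opposite direction, so these inequalities are
equalities on [K], and [K] is a subspace.  Near [(xbar, lam)] the graph of the
subdifferential is then the affine space [(xbar + K) x (lam + K^perp)].

Hence, with [P] the orthogonal projector onto [K], solving [y \in psi x + dg x]
locally amounts to [G x = P y] for the [C^1] map
[G x = P (psi x - psi xbar) + (1 - P) (x - xbar)].  Conditions (a) and (b) both say
that [G'(xbar) = P J + (1 - P)] is invertible.  If it is, a contraction argument
inverts [G] locally.  Conversely, if [w \in K] and [J^T w \in K^perp], a Lipschitz
localization [sigma] gives [t |w|^2 = <w, G (sigma (t w))> = o(t)], whence [w = 0].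
Finally [G'(sigma y) sigma'(y) = P] is solved by the formula in terms of [B]. *)

Set Implicit Arguments.
Unset Strict Implicit.
Unset Printing Implicit Defensive.

Lemma mx_norm_le (R : realType) m n (A : 'M[R]_(m, n)) (e : R) :
  0 <= e -> (forall i j, `|A i j| <= e) -> `|A| <= e.
Proof.
move=> e0 h; rewrite /Num.Def.normr/= mx_normrE (bigmax_le _ e0)//= => i _.
Qed.

Lemma mx_norm_coord (R : realType) m n (A : 'M[R]_(m, n)) i j :
  `|A i j| <= `|A|.
Proof.
rewrite [leRHS]/Num.Def.normr/= mx_normrE.
exact: (le_bigmax _ (fun ij : 'I_m * 'I_n => `|A ij.1 ij.2|) (i, j)).
Qed.

Lemma mx_norm_tr (R : realType) m n (A : 'M[R]_(m, n)) : `|A^T| = `|A|.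
Proof.
apply/eqP; rewrite eq_le; apply/andP; split; apply: mx_norm_le => // i j.
  by rewrite mxE; exact: mx_norm_coord.
by have := mx_norm_coord A^T j i; rewrite mxE.
Qed.

Lemma mx_norm_mul (R : realType) m n p (A : 'M[R]_(m, n)) (B : 'M[R]_(n, p)) :
  `|A *m B| <= n%:R * `|A| * `|B|.
Proof.
apply: mx_norm_le => [|i j]; first by rewrite !mulr_ge0.
rewrite mxE (le_trans (ler_norm_sum _ _ _))//.
rewrite -mulrA -[X in X%:R]card_ord mulr_natl -sumr_const.
by apply: ler_sum => k _; rewrite normrM ler_pM ?mx_norm_coord.
Qed.

Lemma mulmx_lipschitz (R : realType) m n (A : 'M[R]_(m, n)) :
  exists2 k : R, 0 < k & forall p (B : 'M[R]_(n, p)), `|A *m B| <= k * `|B|.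
Proof.
exists (n%:R * `|A| + 1); first by rewrite ltr_wpDl// mulr_ge0.
move=> p B; rewrite (le_trans (mx_norm_mul _ _))// ler_wpM2r//.
by rewrite lerDl.
Qed.

Lemma nbhs_dist (R : realType) m n (a : 'M[R]_(m, n)) (P : set 'M[R]_(m, n)) :
  nbhs a P <-> exists2 d : R, 0 < d & forall x, `|x - a| < d -> P x.
Proof.
split => [/(nbhs_normP a)[d d0 h]|[d d0 h]]; last apply/(nbhs_normP a);
  exists d => // x hx.
  by apply: h => /=; rewrite distrC.
by apply: h; rewrite distrC; exact: hx.
Qed.

Lemma dist_continuous (R : realType) m n p q (f : 'M[R]_(m, n) -> 'M[R]_(p, q))
    (a : 'M[R]_(m, n)) :
  (forall e : R, 0 < e -> exists2 d : R, 0 < d & forall x : 'M[R]_(m, n),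
    `|x - a| < d -> `|f x - f a| < e) -> {for a, continuous f}.
Proof.
move=> h; apply/(@cvgrPdist_lt _ _ _ (nbhs a)) => e /h[d d0 {}h].
by apply/nbhs_dist; exists d => // x /h; rewrite distrC.
Qed.

Lemma mulmx_continuous (R : realType) m n p (A : 'M[R]_(m, n)) :
  continuous (fun B : 'M[R]_(n, p) => A *m B).
Proof.
have [k k0 kA] := mulmx_lipschitz A.
move=> B; apply: dist_continuous => e e0.
exists (k^-1 * e) => [|C hC]; first by rewrite mulr_gt0 ?invr_gt0.
by rewrite -mulmxBr (le_lt_trans (kA _ _))// -ltr_pdivlMl.
Qed.

Lemma diff_grad (R : realType) m (f : 'cV[R]_m -> 'cV[R]_m) (x : 'cV[R]_m) w :
  'd f x w = grad f x *m w.
Proof.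
rewrite [in LHS](matrix_sum_delta w) linear_sum/=.
apply/matrixP => i j; rewrite (ord1 j) summxE mxE; apply: eq_bigr => k _.
by rewrite big_ord_recl big_ord0 addr0 linearZ/= !mxE mulrC.
Qed.

Lemma dist_differentiable (R : realType) m (f : 'cV[R]_m -> 'cV[R]_m)
    (A : 'M[R]_m) (x : 'cV[R]_m) :
  (forall e : R, 0 < e -> exists2 d : R, 0 < d & forall z : 'cV[R]_m, `|z - x| < d ->
    `|f z - f x - A *m (z - x)| <= e * `|z - x|) ->
  differentiable f x /\ grad f x = A.
Proof.
move=> h.
have cA : continuous (mulmx A : 'cV[R]_m -> _) := @mulmx_continuous _ _ _ _ A.
have dE := @diff_unique R 'cV[R]_m 'cV[R]_m f (mulmx A) x cA.
have keep (P Q : Prop) : (P -> Q) -> P -> P /\ Q by move=> PQ p; split; auto.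
have [|fx {}dE] := keep _ _ dE.
  apply/eqaddoP => e /h[d d0 {}h]; apply/nbhs_dist; exists d => // z.
  rewrite subr0 => zd; have := h (z + x).
  by rewrite addrK !fctE /= opprD addrA; exact.
split; first by apply/diff_locallyP; rewrite dE.
by apply/matrixP => i j; rewrite mxE dE/= -colE mxE.
Qed.
Lemma is_derive_line (R : realType) m (f : 'cV[R]_m -> 'cV[R]_m)
    (y v : 'cV[R]_m) (t : R) i : differentiable f (y + t *: v) ->
  is_derive t 1 (fun t : R => f (y + t *: v) i 0)
    ((grad f (y + t *: v) *m v) i 0).
Proof.
pose l (t : R) := y + t *: v; rewrite -/(l t) => df.
have dl : is_diff t l ( *:%R^~ v).
  have -> : ( *:%R^~ v : R -> 'cV[R]_m) = 0 + ( *:%R^~ v).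
    by apply/funext => s; rewrite fctE add0r.
  by apply: is_diffD.
have dfl : differentiable (f \o l) t by apply: differentiable_comp.
have dfl1 := @diff_derivable _ _ _ (f \o l) t 1 dfl.
apply: DeriveDef; first exact: ((derivable_mxP (f \o l) t 1).1 dfl1 i 0).
have := derive_mx dfl1; rewrite deriveE// diff_comp//= diff_val scale1r.
by move=> /matrixP/(_ i 0); rewrite mxE diff_grad.
Qed.

Lemma ball_segment (R : realType) (V : normedModType R) (a x y : V) (d c : R) :
  0 <= c <= 1 -> `|x - a| < d -> `|y - a| < d -> `|y + c *: (x - y) - a| < d.
Proof.
move=> /andP[c0 c1] xd yd.
have -> : y + c *: (x - y) - a = (1 - c) *: (y - a) + c *: (x - a).
  rewrite addrAC scalerBl scale1r -[RHS]addrA [X in _ = _ + X]addrC -scalerBr.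
  by rewrite opprB addrA subrK.
rewrite (le_lt_trans (ler_normD _ _))// !normrZ !ger0_norm ?subr_ge0//.
move: xd yd; move: `|x - a| `|y - a| => A B Ad Bd.
by have [AB|/ltW AB] := leP A B; [apply: le_lt_trans Bd | apply: le_lt_trans Ad];
  nra.
Qed.

Lemma C1_strictly_differentiable (R : realType) m (f : 'cV[R]_m -> 'cV[R]_m)
    (a : 'cV[R]_m) : C1 f ->
  forall e : R, 0 < e -> exists2 d : R, 0 < d & forall x y : 'cV[R]_m,
    `|x - a| < d -> `|y - a| < d ->
    `|f x - f y - grad f a *m (x - y)| <= e * `|x - y|.
Proof.
move=> [df cf] e e0.
have m1 : 0 < m%:R + 1 :> R by rewrite ltr_wpDl.
have /cvgrPdist_lt/(_ (e / (m%:R + 1))) := cf a.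
rewrite divr_gt0// => /(_ isT)/nbhs_dist[d d0 h]; exists d => // x y xd yd.
apply: mx_norm_le => [|i j]; first by rewrite mulr_ge0// ltW.
rewrite (ord1 j) => {j}.
pose phi (t : R) := f (y + t *: (x - y)) i 0.
have dphi (t : R) := @is_derive_line R m f y (x - y) t i (df _).
have cphi : {within `[0 : R, 1], continuous phi}.
  apply: continuous_subspaceT => t; apply: differentiable_continuous.
  by apply/derivable1_diffP; exact: (@ex_derive _ _ _ _ _ _ _ (dphi t)).
have [c /[!in_itv]/= /andP[c0 c1]] := MVT ltr01 (fun t _ => dphi t) cphi.
rewrite /phi scale1r scale0r addr0 addrCA subrr addr0 subr0 mulr1 => hc.
have -> (u v w : 'cV[R]_m) : (u - v - w) i 0 = u i 0 - v i 0 - w i 0.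
  by rewrite !mxE.
rewrite hc.
have -> (A B : 'M[R]_m) (v : 'cV[R]_m) : (A *m v) i 0 - (B *m v) i 0
    = ((A - B) *m v) i 0 by rewrite mulmxBl !mxE.
have c01 : 0 <= c <= 1 by rewrite !ltW.
have /h/ltW {}h := ball_segment c01 xd yd.
rewrite (le_trans (mx_norm_coord _ _ _))// (le_trans (mx_norm_mul _ _))//.
rewrite ler_wpM2r// distrC (le_trans (ler_wpM2l _ h))//.
by rewrite mulrCA ger_pMr// ler_pdivrMr// mul1r lerDl.
Qed.
Lemma unitmx_cV_inj (F : fieldType) m (A : 'M[F]_m) :
  (forall v : 'cV[F]_m, A *m v = 0 -> v = 0) -> A \in unitmx.
Proof.
move=> h; rewrite -unitmx_tr -row_free_unit -kermx_eq0.
apply/eqP/row_matrixP => i; rewrite row0; apply: trmx_inj; rewrite trmx0.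
apply: h; apply: trmx_inj.
by rewrite trmx_mul trmxK -row_mul mulmx_ker row0 trmx0.
Qed.

Lemma strict_local_inverse (R : realType) m (G : 'cV[R]_m -> 'cV[R]_m)
    (a : 'cV[R]_m) (M : 'M[R]_m) : M \in unitmx ->
  (forall e : R, 0 < e -> exists2 d : R, 0 < d & forall x y : 'cV[R]_m,
    `|x - a| < d -> `|y - a| < d ->
    `|G x - G y - M *m (x - y)| <= e * `|x - y|) ->
  exists r0 L : R, [/\ 0 < r0, 0 < L,
    forall x y, `|x - a| <= r0 -> `|y - a| <= r0 ->
      `|x - y| <= L * `|G x - G y| &
    forall r, 0 < r <= r0 -> exists2 s, 0 < s & forall v, `|v - G a| < s ->
      exists2 x, `|x - a| <= r & G x = v].
Proof.
move=> uM hG; have [k k0 kN] := mulmx_lipschitz (invmx M).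
have k20 : 0 < 2 * k by rewrite mulr_gt0.
have [|d d0 {}hG] := hG (2 * k)^-1; first by rewrite invr_gt0.
have half x y : `|x - a| <= d / 2 -> `|y - a| <= d / 2 ->
    `|x - y - invmx M *m (G x - G y)| <= 2^-1 * `|x - y|.
  move=> xd yd; have lt_d z : z <= d / 2 -> z < d by lra.
  have /(ler_wpM2l (ltW k0)) := hG x y (lt_d _ xd) (lt_d _ yd).
  have kk : k * (2 * k)^-1 = 2^-1 by field; rewrite gt_eqF.
  rewrite distrC mulrA kk.
  apply: le_trans; apply: le_trans (kN _ _).
  by rewrite [leRHS](_ : _ = `|x - y - invmx M *m (G x - G y)|)// mulmxBr mulKmx.
exists (d / 2), (2 * k); split=> [|//|x y xd yd|r /andP[r0 rd]].
- by rewrite divr_gt0.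
- have := half _ _ xd yd; have := kN _ (G x - G y).
  have := ler_normD (x - y - invmx M *m (G x - G y)) (invmx M *m (G x - G y)).
  by rewrite subrK; lra.
exists (r / (2 * k)) => [|v hv]; first by rewrite divr_gt0.
pose U : set 'cV[R]_m := [set x | `|x - a| <= r].
pose Phi x := x - invmx M *m (G x - v).
have PhiB x y : Phi x - Phi y = x - y - invmx M *m (G x - G y).
  rewrite /Phi opprB [_ - y]addrC addrACA; congr (_ + _).
  by rewrite addrC -mulmxBr -mulmxN !opprB addrA subrK.
have PhiU : set_fun U U Phi.
  move=> x xr; rewrite /U /= -[Phi x](subrK (Phi a)) -addrA PhiB.
  have -> : Phi a - a = invmx M *m (v - G a).
    by rewrite /Phi addrAC subrr add0r -mulmxN opprB.
  have aU : `|a - a| <= d / 2 by rewrite subrr normr0; lra.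
  have := half x a (le_trans xr rd) aU.
  rewrite (ltr_pdivlMr _ _ k20) in hv.
  have := kN _ (v - G a); have := ler_normD (x - a - invmx M *m (G x - G a))
    (invmx M *m (v - G a)); rewrite /U /= in xr; lra.
pose X : completeNormedModType R :=
  HB.pack 'cV[R]_m (Uniform_isComplete.Build 'cV[R]_m (@cauchy_cvg _)).
pose F : {fun (U : set X) >-> (U : set X)} :=
  HB.pack (Phi : X -> X) (isFun.Build X X U U Phi PhiU).
have ctrF : is_contraction F.
  exists (2^-1)%:nng; split => /=; first by rewrite invf_lt1// ltr1n.
  move=> [x y] [/= xU yU]; rewrite [X in `|X|]PhiB.
  by apply: half; [apply: le_trans xU rd|apply: le_trans yU rd].
have cU : closed (U : set X).
  have -> : U = closed_ball_ Num.norm a r.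
    by apply/funext => x; rewrite /U /closed_ball_ /= distrC.
  exact: closed_closed_ball_.
have [|x xU fx] := banach_fixed_point ctrF cU.
  by exists a; rewrite /U /= subrr normr0 ltW.
exists x => //; apply/subr0_eq; apply: (can_inj (mulKmx (_ : invmx M \in unitmx))).
  by rewrite unitmx_inv.
rewrite mulmx0; apply: oppr_inj; rewrite oppr0; apply: (addrI x).
by rewrite addr0 [RHS]fx.
Qed.
Lemma unitmx_perturbation (R : realType) m (M0 : 'M[R]_m) : M0 \in unitmx ->
  exists d c : R, [/\ 0 < d, 0 < c & forall M, `|M - M0| < d ->
    M \in unitmx /\ forall p (X X0 : 'M[R]_(m, p)), M *m X = M0 *m X0 ->
      `|X - X0| <= c * `|M - M0| * `|X0|].
Proof.
move=> uM; have [k k0 kN] := mulmx_lipschitz (invmx M0).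
pose c := k * (m%:R + 1); have m1 : 0 < m%:R + 1 :> R by rewrite ltr_wpDl.
have c0 : 0 < c by rewrite mulr_gt0.
exists (2 * c)^-1, (2 * c); split=> [||M hM]; rewrite ?invr_gt0 ?mulr_gt0//.
have hMc : c * `|M - M0| <= 2^-1.
  by rewrite -[ltRHS]mul1r ltr_pdivlMr ?mulr_gt0// in hM; nra.
have est p (X X0 : 'M[R]_(m, p)) : M *m X = M0 *m X0 ->
    `|X - X0| <= 2 * c * `|M - M0| * `|X0|.
  move=> MX; have X_X0 : X - X0 = invmx M0 *m ((M0 - M) *m X).
    by rewrite mulmxBl MX mulmxBr !mulKmx.
  have h1 : `|X - X0| <= c * `|M - M0| * `|X|.
    rewrite X_X0 (le_trans (kN _ _))// /c -!mulrA (ler_wpM2l (ltW k0))//.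
    rewrite (le_trans (mx_norm_mul _ _))// distrC -mulrA ler_wpM2r ?mulr_ge0//.
    by rewrite lerDl.
  move: h1; have := ler_normD (X - X0) X0; rewrite subrK.
  have t0 : 0 <= c * `|M - M0| by rewrite mulr_ge0// ltW.
  move: hMc t0 (normr_ge0 (X - X0)); rewrite -(mulrA 2).
  by move: (c * _) `|X - X0| `|X| `|X0| => t a b x; nra.
split=> //; apply: unitmx_cV_inj => v Mv.
have /est : M *m v = M0 *m 0 by rewrite mulmx0.
by rewrite normr0 mulr0 subr0 normr_le0 => /eqP.
Qed.

Lemma dotvE (R : realType) m (u v : 'cV[R]_m) :
  dotv u v = \sum_i u i 0 * v i 0.
Proof. by rewrite /dotv mxE; apply: eq_bigr => i _; rewrite mxE. Qed.

Lemma dotvC (R : realType) m (u v : 'cV[R]_m) : dotv u v = dotv v u.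
Proof. by rewrite !dotvE; apply: eq_bigr => i _; rewrite mulrC. Qed.

Lemma dotvDl (R : realType) m (u v w : 'cV[R]_m) :
  dotv (u + v) w = dotv u w + dotv v w.
Proof. by rewrite /dotv raddfD/= mulmxDl mxE. Qed.

Lemma dotvDr (R : realType) m (u v w : 'cV[R]_m) :
  dotv w (u + v) = dotv w u + dotv w v.
Proof. by rewrite /dotv mulmxDr mxE. Qed.

Lemma dotvNl (R : realType) m (u v : 'cV[R]_m) : dotv (- u) v = - dotv u v.
Proof. by rewrite /dotv raddfN/= mulNmx mxE. Qed.

Lemma dotvNr (R : realType) m (u v : 'cV[R]_m) : dotv u (- v) = - dotv u v.
Proof. by rewrite /dotv mulmxN mxE. Qed.

Lemma dotvZl (R : realType) m a (u v : 'cV[R]_m) :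
  dotv (a *: u) v = a * dotv u v.
Proof. by rewrite /dotv linearZ/= -scalemxAl mxE. Qed.

Lemma dotvZr (R : realType) m a (u v : 'cV[R]_m) :
  dotv u (a *: v) = a * dotv u v.
Proof. by rewrite /dotv -scalemxAr mxE. Qed.

Lemma dotv0 (R : realType) m (u : 'cV[R]_m) : dotv u 0 = 0.
Proof. by rewrite /dotv mulmx0 mxE. Qed.

Lemma dot0v (R : realType) m (u : 'cV[R]_m) : dotv 0 u = 0.
Proof. by rewrite dotvC dotv0. Qed.

Lemma dotv_mulmxl (R : realType) m n (A : 'M[R]_(m, n)) u v :
  dotv (A *m u) v = dotv u (A^T *m v).
Proof. by rewrite /dotv trmx_mul mulmxA. Qed.

Lemma dotvv_eq0 (R : realType) m (u : 'cV[R]_m) : dotv u u = 0 -> u = 0.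
Proof.
rewrite dotvE => /eqP; rewrite psumr_eq0 => [/allP h|i _]; last first.
  by rewrite -expr2 sqr_ge0.
apply/matrixP => i j; rewrite (ord1 j) mxE; apply/eqP.
by have := h i (mem_index_enum _); rewrite mulf_eq0 orbb.
Qed.

Lemma dotv_norm (R : realType) m (u v : 'cV[R]_m) :
  `|dotv u v| <= m%:R * `|u| * `|v|.
Proof.
by rewrite (le_trans (mx_norm_coord _ _ _))// (le_trans (mx_norm_mul _ _))//
  mx_norm_tr.
Qed.

Lemma gram_unitmx (R : realType) m n (E : 'M[R]_(m, n)) :
  row_free E -> E *m E^T \in unitmx.
Proof.
move=> fE; apply: unitmx_cV_inj => v; rewrite -mulmxA => Ev.
have /dotvv_eq0 Etv : dotv (E^T *m v) (E^T *m v) = 0.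
  by rewrite dotv_mulmxl trmxK Ev dotv0.
apply: trmx_inj; apply/eqP; rewrite trmx0 -(mulmx_free_eq0 _ fE).
by rewrite -[E]trmxK -trmx_mul Etv trmx0.
Qed.

Lemma kernel_projector (R : realType) m n (D : 'M[R]_(n, m)) :
  exists (P : 'M[R]_m) (Q : 'M[R]_(n, m)),
    [/\ P^T = P, P *m P = P, D *m P = 0 & 1%:M - P = D^T *m Q].
Proof.
set E := row_base D; have fE : row_free E := row_base_free D.
have /submxP[Y EY] : (E <= D)%MS by rewrite (eq_row_base D).
have DE : D = col_base D *m E by rewrite mulmx_base.
clearbody E; have uG := gram_unitmx fE; set G := E *m E^T in uG.
pose Z := E^T *m invmx G *m E.
have EZ : E *m Z = E by rewrite /Z !mulmxA mulmxV// mul1mx.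
have ZZ : Z *m Z = Z by rewrite {1}/Z -mulmxA EZ.
exists (1%:M - Z), (Y^T *m invmx G *m E); split.
- have GT : G^T = G by rewrite trmx_mul trmxK.
  by rewrite raddfB/= trmx1 /Z !trmx_mul trmxK trmx_inv GT mulmxA.
- by rewrite mulmxBr mulmx1 mulmxBl mul1mx ZZ subrr subr0.
- by rewrite DE -mulmxA mulmxBr mulmx1 EZ subrr mulmx0.
- by rewrite opprB addrC subrK /Z {1}EY trmx_mul !mulmxA.
Qed.
Lemma affine_hull_combination (R : realType) m (C : set 'cV[R]_m) n
    (x : 'cV[R]_m) (y : 'I_n -> 'cV[R]_m) (t : 'I_n -> R) :
  C x -> (forall i, C (y i)) -> affine_hull C (x + \sum_i t i *: (y i - x)).
Proof.
move=> Cx Cy; exists n.+1, (fun j => oapp y x (unlift ord0 j)).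
exists (fun j => oapp t (1 - \sum_i t i) (unlift ord0 j)); split=> [j|].
  by case: (unlift _ _) => /=.
rewrite !big_ord_recl unlift_none/=.
rewrite [X in _ - _ + X](eq_bigr t) => [|i _]; last by rewrite liftK.
rewrite subrK; split=> //.
rewrite [in RHS](eq_bigr (fun i => t i *: y i)) => [|i _]; last by rewrite liftK.
under eq_bigr do rewrite scalerBr; rewrite sumrB -scaler_suml scalerBl scale1r.
by rewrite addrA addrAC.
Qed.

Lemma affine_hull_line (R : realType) m (C : set 'cV[R]_m) (x y : 'cV[R]_m) t :
  C x -> C y -> affine_hull C (x + t *: (y - x)).
Proof.
move=> Cx Cy; have := @affine_hull_combination R m C 1 x (fun=> y) (fun=> t) Cx.
by rewrite big_ord_recl big_ord0 addr0; apply.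
Qed.

Lemma polyhedral_tangent (R : realType) m (g : 'cV[R]_m -> \bar R)
    (x0 : 'cV[R]_m) (y0 : R) : polyhedral_fun g -> g x0 = y0%:E ->
  exists n (a : 'I_n -> 'cV[R]_m) (c : 'I_n -> R) (d : R),
    [/\ 0 < d, forall i, c i <= 0,
      forall x t, (g x <= t%:E)%E ->
        forall i, dotv (a i) (x - x0) + c i * (t - y0) <= 0 &
      forall (w : 'cV[R]_m) (s : R), `|w| < d -> `|s| < d ->
        (forall i, dotv (a i) w + c i * s <= 0) -> (g (x0 + w)%R <= (y0 + s)%:E)%E].
Proof.
move=> [_ [_ [n [a [c [b epi]]]]]] gx0.
pose sl i := b i - (dotv (a i) x0 + c i * y0).
have sl0 i : 0 <= sl i by rewrite subr_ge0; apply: (epi x0 y0).1; rewrite gx0.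
pose K i := m%:R * `|a i| + `|c i| + 1.
have K0 i : 0 < K i by rewrite ltr_wpDl// addr_ge0// mulr_ge0.
(* Inactive constraints are replaced by the trivial constraint [0 <= 0]. *)
pose a' i := if sl i == 0 then a i else 0.
pose c' i := if sl i == 0 then c i else 0.
pose d := \big[Num.min/1]_(i < n | sl i != 0) (sl i / K i).
exists n, a', c', d; split=> [|i|x t gxt i|w s wd sd h].
- by apply: lt_bigmin => // i sli; rewrite divr_gt0// lt_neqAle eq_sym sli sl0.
- rewrite /c'; case: eqP => // sli.
  have : (g x0 <= (y0 + 1)%:E)%E by rewrite gx0 lee_fin lerDl.
  by move=> /(epi x0 _).1/(_ i); move: sli; rewrite /sl; lra.
- have := (epi x t).1 gxt i; rewrite /a' /c'; case: eqP => [|_ _].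
    by rewrite /sl dotvDr dotvNr; lra.
  by rewrite dot0v mul0r addr0.
apply/(epi _ _).2 => i; have := h i; rewrite /a' /c' dotvDr.
case: eqP => [|/eqP sli _]; first by rewrite /sl; lra.
have dK : d * K i <= sl i by rewrite -ler_pdivlMr//; exact: bigmin_le_cond.
have h1 := dotv_norm (a i) w.
have h2 : `|c i * s| <= `|c i| * `|s| by rewrite normrM.
have h3 : m%:R * `|a i| * `|w| <= m%:R * `|a i| * d.
  by rewrite ler_wpM2l ?mulr_ge0// ltW.
have h4 : `|c i| * `|s| <= `|c i| * d by rewrite ler_wpM2l// ltW.
have d0 := le_lt_trans (normr_ge0 _) wd.
move: (le_trans (ler_norm _) h1) (le_trans (ler_norm _) h2) h3 h4 dK.
by rewrite /K /sl; nra.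
Qed.

Section polyhedral.
Variables (R : realType) (m : nat) (g : 'cV[R]_m -> \bar R).
Variables (x0 : 'cV[R]_m) (y0 : R) (n : nat).
Variables (a : 'I_n -> 'cV[R]_m) (c : 'I_n -> R) (d : R).
Let T (w : 'cV[R]_m) (s : R) := forall i, dotv (a i) w + c i * s <= 0.
Hypotheses (gNy : forall x, g x != -oo%E) (gx0 : g x0 = y0%:E) (d0 : 0 < d).
Hypothesis c_le0 : forall i, c i <= 0.
Hypothesis epi_T : forall x t, (g x <= t%:E)%E -> T (x - x0) (t - y0).
Hypothesis T_epi : forall (w : 'cV[R]_m) (s : R), `|w| < d -> `|s| < d -> T w s ->
  (g (x0 + w)%R <= (y0 + s)%:E)%E.

Let TZ (w : 'cV[R]_m) (s t : R) : 0 <= t -> T w s -> T (t *: w) (t * s).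
Proof.
by move=> t0 h i; rewrite dotvZr mulrCA -mulrDr mulr_ge0_le0.
Qed.

Let small (w : 'cV[R]_m) (s e : R) : 0 < e ->
  exists t : R, [/\ 0 < t, t < e, `|t *: w| < d & `|t * s| < d].
Proof.
move=> e0; pose q : R := `|w| + `|s| + 1.
have q0 : 0 < q by rewrite ltr_wpDl// addr_ge0.
have qi : 0 < q^-1 by rewrite invr_gt0.
exists (Num.min e d * q^-1 / 2).
have me0 : 0 < Num.min e d by rewrite lt_min e0.
have t0 : 0 < Num.min e d * q^-1 / 2 by rewrite divr_gt0// mulr_gt0.
have ltq z f : 0 <= z -> z <= q -> Num.min e d <= f -> Num.min e d * q^-1 / 2 * z < f.
  move=> z0 zq mf; apply: lt_le_trans mf; rewrite -2!mulrA gtr_pMr//.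
  by rewrite mulrC -ltr_pdivlMr ?invr_gt0// invrK mulrC -ltr_pdivlMr ?invr_gt0//; lra.
split=> //.
- have := @ltq 1 e ler01; rewrite mulr1; apply; last by rewrite ge_min lexx.
  by rewrite /q lerDr addr_ge0.
- rewrite normrZ gtr0_norm//; apply: ltq; rewrite ?ge_min ?lexx ?orbT//.
  by rewrite /q -addrA lerDl addr_ge0.
- rewrite normrM gtr0_norm//; apply: ltq; rewrite ?ge_min ?lexx ?orbT//.
  by rewrite /q addrAC lerDr addr_ge0.
Qed.

Lemma subdiff_polyhedral v :
  subdiff g x0 v <-> (forall w s, T w s -> dotv v w <= s).
Proof.
split=> [[_ h] w s Tws|h].
  have [t [t0 _ tw ts]] := small w s ltr01.
  have := le_trans (h _) (T_epi tw ts (TZ (ltW t0) Tws)).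
  by rewrite gx0 -EFinD lee_fin [x0 + _]addrC addrK lerD2l dotvZr ler_pM2l.
split=> [|z]; first by rewrite gx0.
have := gNy z; case E : (g z) => [t| |]//= _; last by rewrite leey.
rewrite gx0 -EFinD lee_fin -lerBrDl; apply: h.
by apply: epi_T; rewrite E.
Qed.

Lemma crit_cone_polyhedral l : subdiff g x0 l ->
  forall w, crit_cone g x0 l w <-> T w (dotv l w).
Proof.
move=> ldg w; split.
  rewrite /crit_cone /= => h i; apply/ler_addgt0Pr => e e0; rewrite add0r.
  pose K := m%:R * `|a i| + `|c i| + 1.
  have K0 : 0 < K by rewrite ltr_wpDl// addr_ge0// mulr_ge0.
  pose de := e / K; have de0 : 0 < de by rewrite divr_gt0.
  have : (subderiv g x0 w < (dotv l w + de)%:E)%E by rewrite -h lte_fin ltrDl.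
  move=> /(le_lt_trans (ereal_sup_ubound _)) => /(_ _ (ex_intro2 _ _ de de0 erefl)).
  move=> /ereal_inf_lt[q [t [w' [/andP[t0 _] [ww' ->]]]]].
  have := gNy (x0 + t *: w'); case E : (g _) => [r| |]// _; last first.
    by rewrite gx0/= gt0_mulye ?lte_fin ?invr_gt0.
  rewrite gx0 -EFinB -EFinM lte_fin ltr_pdivrMr// => rt.
  have /epi_T/(_ i) : (g (x0 + t *: w')%R <= r%:E)%E by rewrite E.
  rewrite [x0 + _]addrC addrK dotvZr => Ti.
  have Kde : K * de = e by rewrite /de mulrC divfK ?gt_eqF.
  have h1 := le_trans (ler_norm _) (dotv_norm (a i) (w - w')).
  rewrite distrC in ww'; rewrite dotvDr dotvNr in h1.
  have h3 : m%:R * `|a i| * `|w - w'| <= m%:R * `|a i| * de.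
    by rewrite ler_wpM2l ?mulr_ge0// ltW.
  have ci := c_le0 i; have cN : `|c i| = - c i by rewrite ler0_norm.
  have h4 : t * (dotv (a i) w' + c i * (dotv l w + de)) <= 0.
    apply: le_trans Ti; rewrite mulrDr lerD2l mulrCA ler_wnM2l//.
    by rewrite mulrC ltW.
  rewrite pmulr_rle0// in h4; rewrite -Kde /K cN; nra.
move=> Tw; rewrite /crit_cone /=; apply/eqP; rewrite eq_le; apply/andP; split.
  apply/lee_addgt0Pr => e e0.
  pose K := m%:R * `|l| + 1; have K0 : 0 < K by rewrite ltr_wpDl// mulr_ge0.
  pose de := e / K; have de0 : 0 < de by rewrite divr_gt0.
  rewrite -leeBlDr//; apply: le_trans (ereal_sup_ubound _); last by exists de.
  apply: le_ereal_inf_tmp => _ [t [w' [/andP[t0 _] [ww' ->]]]].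
  have := ldg.2 (x0 + t *: w'); have := gNy (x0 + t *: w').
  case: (g (x0 + _)) => [r| |]// _; last first.
    by rewrite gx0/= gt0_mulye ?leey ?lte_fin ?invr_gt0.
  rewrite gx0 -!EFinB -EFinD -EFinM !lee_fin [x0 + _]addrC addrK dotvZr => h.
  rewrite ler_pdivlMr//.
  have Kde : K * de = e by rewrite /de mulrC divfK ?gt_eqF.
  have h1 := le_trans (ler_norm _) (dotv_norm l (w - w')).
  rewrite distrC in ww'; rewrite dotvDr dotvNr in h1.
  have h3 : m%:R * `|l| * `|w - w'| <= m%:R * `|l| * de.
    by rewrite ler_wpM2l ?mulr_ge0// ltW.
  have : dotv l w - e <= dotv l w' by rewrite -Kde /K; lra.
  by move=> /(ler_wpM2l (ltW t0)); lra.
apply: ge_ereal_sup => _ [e /= e0 <-].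
have [t [t0 te tw ts]] := small w (dotv l w) e0.
apply: le_trans (ereal_inf_lbound _) _.
  exists t, w; split; first by rewrite t0.
  by rewrite subrr normr0; split.
have := T_epi tw ts (TZ (ltW t0) Tw); have := gNy (x0 + t *: w).
case: (g (x0 + _)) => [r| |]// _; rewrite gx0 -EFinB -EFinM !lee_fin => h.
by rewrite ler_pdivrMr//; lra.
Qed.


Lemma nondegenerate_reduction l : ri (subdiff g x0) l ->
  exists P : 'M[R]_m, [/\ P^T = P, P *m P = P,
    forall w, crit_cone g x0 l w <-> P *m w = w &
    exists2 e : R, 0 < e & forall x v : 'cV[R]_m, `|x - x0| < e -> `|v - l| < e ->
      (subdiff g x v <-> P *m (x - x0) = x - x0 /\ P *m (v - l) = 0)].
Proof.
move=> [Cl [e0 [e0_gt0 hri]]].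
have Cl' := (subdiff_polyhedral l).1 Cl.
pose b i := a i + c i *: l.
(* [l + k i *: b i] is [(- c i)^-1 *: a i] if [c i < 0] and [l + a i] if [c i = 0]. *)
pose k i := if c i < 0 then (- c i)^-1 else 1.
have k0 i : 0 < k i by rewrite /k; case: ifP => // ci; rewrite invr_gt0 oppr_gt0.
have Tb w : T w (dotv l w) <-> forall i, dotv (b i) w <= 0.
  by split=> h i; have := h i; rewrite dotvDl dotvZl.
have Cb i : subdiff g x0 (l + k i *: b i).
  apply/subdiff_polyhedral => w s Tws; have := Cl' _ _ Tws; have := Tws i.
  rewrite dotvDl dotvZl dotvDl dotvZl /k; have := c_le0 i.
  rewrite le_eqVlt => /orP[/eqP ->|ci]; first by rewrite ltxx; lra.
  rewrite ci => h1 _; rewrite addrC -lerBrDr ler_pdivrMl ?oppr_gt0//; lra.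
have critb w : crit_cone g x0 l w <-> forall i, dotv (b i) w = 0.
  split=> [/(crit_cone_polyhedral Cl) Tw i|bw]; last first.
    by apply/(crit_cone_polyhedral Cl)/Tb => i; rewrite bw.
  apply: le_anti; rewrite ((Tb w).1 Tw i)/=.
  pose t := e0 / (`|k i *: b i| + 1).
  have q0 : 0 < `|k i *: b i| + 1 by rewrite ltr_wpDl.
  have t0 : 0 < t by rewrite divr_gt0.
  have /hri : affine_hull (subdiff g x0) (l + (- t) *: (l + k i *: b i - l)).
    exact: affine_hull_line.
  rewrite [l + k i *: _]addrC addrK [l + _]addrC addrK => /(_ _)/wrap[].
    rewrite normrZ normrN gtr0_norm// /t -mulrA gtr_pMr// mulrC.
    by rewrite ltr_pdivrMr// mul1r ltrDl.
  move=> /subdiff_polyhedral/(_ _ _ Tw).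
  rewrite dotvDl !dotvZl gerDr mulNr oppr_le0 => h.
  by rewrite -(pmulr_rge0 _ (k0 i)) -(pmulr_rge0 _ t0).
pose D : 'M[R]_(n, m) := \matrix_(i, j) b i j 0.
have DE w : D *m w = 0 <-> forall i, dotv (b i) w = 0.
  have Di i : (D *m w) i 0 = dotv (b i) w.
    by rewrite mxE dotvE; apply: eq_bigr => j _; rewrite mxE.
  split=> [Dw i|h]; first by rewrite -Di Dw mxE.
  by apply/matrixP => i j; rewrite (ord1 j) Di h mxE.
have [P [Q [PT PP DP PQ]]] := kernel_projector D.
have critP w : crit_cone g x0 l w <-> P *m w = w.
  rewrite critb -DE; split=> [Dw|<-]; last by rewrite mulmxA DP mul0mx.
  have : (1%:M - P) *m w = 0.
    have -> : 1%:M - P = (1%:M - P)^T by rewrite raddfB/= trmx1 PT.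
    by rewrite PQ trmx_mul trmxK -mulmxA Dw mulmx0.
  by rewrite mulmxBl mul1mx => /subr0_eq.
exists P; split=> //.
pose q := m%:R * (`|l| + 1) + 1.
have q0 : 0 < q by rewrite /q ltr_wpDl// mulr_ge0// addr_ge0.
pose e := Num.min 1 (Num.min (e0 / 2) (d / (2 * q))).
have e_gt0 : 0 < e by rewrite !lt_min ltr01 !divr_gt0// mulr_gt0.
have e1 : e <= 1 by rewrite ge_min lexx.
have ee0 : e <= e0 / 2 by rewrite !ge_min lexx !orbT.
have ed : e * (2 * q) <= d.
  by rewrite -ler_pdivlMr ?mulr_gt0// !ge_min lexx !orbT.
have q1 : 1 <= q by rewrite /q -lerBlDr subrr mulr_ge0// addr_ge0.
exists e => // x v; set w : 'cV[R]_m := x - x0 => we ve.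
have xE : x = x0 + w by rewrite addrC subrK.
have bound (u : 'cV[R]_m) : `|u - l| < e -> `|dotv u w| * 2 < d.
  move=> ul; apply: lt_le_trans ed.
  have h := dotv_norm u w.
  have hu : `|u| <= `|l| + 1.
    by have := ler_normD (u - l) l; rewrite subrK; lra.
  have h2 : m%:R * `|u| * `|w| <= m%:R * (`|l| + 1) * `|w|.
    by rewrite ler_wpM2r// ler_wpM2l.
  have h3 : m%:R * (`|l| + 1) * `|w| <= m%:R * (`|l| + 1) * e.
    by rewrite ler_wpM2l ?(ltW we)// mulr_ge0// addr_ge0.
  by rewrite /q; lra.
have wd : `|w| * 2 < d by apply: lt_le_trans ed; nra.
have ll : `|l - l| < e by rewrite subrr normr0.
split=> [[gxfin Sv]|[Pw Pv]].
  move: gxfin Sv (Sv x0) (Cl.2 x); case gx : (g x) => [r| |]// _.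
  rewrite gx0 -!EFinD !lee_fin -/w -[x0 - x]opprB -/w dotvNr.
  move=> hv hx0 hl; pose s := r - y0.
  have Tws : T w s by apply: epi_T; rewrite gx.
  have bv := bound v ve; have bl := bound l ll.
  have s2 : `|2 * s| < d.
    have := ler_norm (dotv v w); have := ler_norm (- dotv l w); rewrite normrN.
    by rewrite ltr_norml /s => ? ?; apply/andP; split; lra.
  have w2 : `|2 *: w| < d by rewrite normrZ ger0_norm// mulrC.
  have := le_trans (hv _) (T_epi w2 s2 (TZ (ler0n R 2) Tws)).
  rewrite -EFinD lee_fin.
  have -> : x0 + 2 *: w - x = w.
    by rewrite xE opprD addrACA subrr add0r scaler_nat mulr2n addrK.
  move=> hv2; have vw : dotv v w = s by rewrite /s in hv2 *; lra.
  have Cv : subdiff g x0 v.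
    split=> [|z]; first by rewrite gx0.
    have := hv z; rewrite gx0 -!EFinD.
    have -> // : r + dotv v (z - x) = y0 + dotv v (z - x0).
    by rewrite xE opprD addrA dotvDr dotvNr vw /s; lra.
  have C2 : subdiff g x0 (l + 2 *: (v - l)).
    apply: hri; first exact: affine_hull_line.
    by rewrite addrC addKr normrZ ger0_norm//; lra.
  have := (subdiff_polyhedral _).1 C2 _ _ Tws.
  rewrite dotvDl dotvZl dotvDl dotvNl vw => lw.
  have {}lw : dotv l w = s by have := Cl' _ _ Tws; lra.
  split; first by apply/critP/(crit_cone_polyhedral Cl); rewrite lw.
  apply: dotvv_eq0; rewrite dotv_mulmxl PT mulmxA PP.
  set u := P *m (v - l); have Pu : P *m u = u by rewrite /u mulmxA PP.
  have Pu' : P *m - u = - u by rewrite mulmxN Pu.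
  have Cv' := (subdiff_polyhedral _).1 Cv.
  have /(crit_cone_polyhedral Cl)/Cv' := (critP _).2 Pu.
  have /(crit_cone_polyhedral Cl)/Cv' := (critP _).2 Pu'.
  by rewrite !dotvNr dotvDl dotvNl; lra.
have Tw : T w (dotv l w) by apply/(crit_cone_polyhedral Cl)/critP.
have bl := bound l ll.
have gx : g x = (y0 + dotv l w)%:E.
  apply/eqP; rewrite eq_le xE T_epi//=;
    [|by have := normr_ge0 w; lra|by have := normr_ge0 (dotv l w); lra].
  by have := Cl.2 (x0 + w); rewrite gx0 -EFinD [x0 + _]addrC addrK.
have Cv : subdiff g x0 v.
  have [u vl] : exists u, v - l = D^T *m u.
    by exists (Q *m (v - l)); rewrite mulmxA -PQ mulmxBl mul1mx Pv subr0.
  have {}vl : v = l + \sum_i (u i 0 / k i) *: (l + k i *: b i - l).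
    apply/eqP; rewrite addrC -subr_eq {}vl; apply/eqP.
    apply/matrixP => j j0; rewrite (ord1 j0) mxE summxE; apply: eq_bigr => i _.
    rewrite [l + _ *: b i]addrC addrK scalerA divfK ?gt_eqF// mulrC.
    by rewrite [in RHS]mxE [D^T _ _]mxE [D _ _]mxE.
  apply: hri; last by lra.
  by rewrite vl; apply: affine_hull_combination.
split=> [|z]; first by rewrite gx.
have := Cv.2 z; rewrite gx gx0 -!EFinD.
have vw : dotv (v - l) w = 0 by rewrite -Pw -[P]PT -dotv_mulmxl Pv dot0v.
have -> : dotv v (z - x0) = dotv v (z - x) + dotv v w.
  by rewrite -dotvDr /w addrA subrK.
by move: vw; rewrite dotvDl dotvNl => vw; congr (_ <= _)%E; congr (_%:E); lra.
Qed.

End polyhedral.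
Lemma polyhedral_reduction (R : realType) m (g : 'cV[R]_m -> \bar R)
    (x0 l : 'cV[R]_m) : polyhedral_fun g -> ri (subdiff g x0) l ->
  exists P : 'M[R]_m, [/\ P^T = P, P *m P = P,
    forall w, crit_cone g x0 l w <-> P *m w = w &
    exists2 e : R, 0 < e & forall x v : 'cV[R]_m, `|x - x0| < e -> `|v - l| < e ->
      (subdiff g x v <-> P *m (x - x0) = x - x0 /\ P *m (v - l) = 0)].
Proof.
move=> pg /[dup] ril [[gfin _] _]; have gx0 : g x0 = (fine (g x0))%:E by rewrite fineK.
have [n [a [c [d [d0 c0 eT Te]]]]] := polyhedral_tangent pg gx0.
exact (nondegenerate_reduction pg.1 gx0 d0 c0 eT Te ril).
Qed.

Lemma eq_mulmx_cV (R : pzRingType) m n (A B : 'M[R]_(m, n)) :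
  (forall v : 'cV[R]_n, A *m v = B *m v) -> A = B.
Proof.
by move=> AB; apply/matrixP => i j; have := AB (delta_mx j 0);
  rewrite -!colE => /matrixP/(_ i 0); rewrite !mxE.
Qed.

Section reduced_equation.
Variables (R : realType) (m : nat) (psi : 'cV[R]_m -> 'cV[R]_m) (x0 : 'cV[R]_m).
Variable P : 'M[R]_m.
Hypotheses (psiC1 : C1 psi) (PT : P^T = P) (PP : P *m P = P).

Definition reduced_map (x : 'cV[R]_m) : 'cV[R]_m :=
  P *m (psi x - psi x0) + (1%:M - P) *m (x - x0).

Definition reduced_grad (x : 'cV[R]_m) : 'M[R]_m := P *m grad psi x + (1%:M - P).

Lemma proj_compl : P *m (1%:M - P) = 0.
Proof. by rewrite mulmxBr mulmx1 PP subrr. Qed.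

Lemma compl_proj : (1%:M - P) *m P = 0.
Proof. by rewrite mulmxBl mul1mx PP subrr. Qed.

Lemma compl_compl : (1%:M - P) *m (1%:M - P) = 1%:M - P.
Proof. by rewrite mulmxBl mul1mx proj_compl subr0. Qed.

Lemma compl_eq0 n (v : 'M[R]_(m, n)) : (1%:M - P) *m v = 0 <-> P *m v = v.
Proof.
rewrite mulmxBl mul1mx; split=> [/subr0_eq //|->]; exact: subrr.
Qed.

Lemma reduced_mapE x y : reduced_map x = P *m y <->
  P *m (x - x0) = x - x0 /\ P *m (y - psi x - - psi x0) = 0.
Proof.
rewrite /reduced_map; split=> [E|[/compl_eq0 -> yx]].
  split.
    apply/compl_eq0; have := congr1 (mulmx (1%:M - P)) E.
    by rewrite mulmxDr !mulmxA compl_proj compl_compl !mul0mx add0r.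
  have := congr1 (mulmx P) E.
  rewrite mulmxDr !mulmxA PP proj_compl mul0mx addr0 => {}E.
  by rewrite opprK -addrA [- _ + _]addrC -opprB mulmxBr E subrr.
move: yx; rewrite opprK -addrA [- _ + _]addrC -opprB mulmxBr addr0.
by move=> /subr0_eq.
Qed.

Lemma reduced_map0 : reduced_map x0 = 0.
Proof. by rewrite /reduced_map !subrr !mulmx0 addr0. Qed.

Lemma reduced_map_strict a : forall e : R, 0 < e -> exists2 d : R, 0 < d &
  forall x y : 'cV[R]_m, `|x - a| < d -> `|y - a| < d ->
  `|reduced_map x - reduced_map y - reduced_grad a *m (x - y)| <= e * `|x - y|.
Proof.
have [k k0 kP] := mulmx_lipschitz P.
move=> e e0; have [|d d0 h] := C1_strictly_differentiable a psiC1 (e := e / k).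
  by rewrite divr_gt0.
exists d => // x y xd yd.
have -> : reduced_map x - reduced_map y - reduced_grad a *m (x - y) =
    P *m (psi x - psi y - grad psi a *m (x - y)).
  rewrite /reduced_map /reduced_grad opprD addrACA -!mulmxBr !opprB.
  rewrite ![_ + (x0 - _)]addrA ![_ + (psi x0 - _)]addrA !subrK.
  by rewrite mulmxDl opprD addrACA subrr addr0 -mulmxA -mulmxBr.
rewrite (le_trans (kP _ _))// -ler_pdivlMl// mulrA [k^-1 * e]mulrC.
exact: h.
Qed.

Lemma reduced_grad_continuous a (e : R) : 0 < e -> exists2 d : R, 0 < d &
  forall x : 'cV[R]_m, `|x - a| < d -> `|reduced_grad x - reduced_grad a| < e.
Proof.
move=> e0; have [k k0 kP] := mulmx_lipschitz P.
have /cvgrPdist_lt/(_ (e / k)) := psiC1.2 a.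
rewrite divr_gt0// => /(_ isT)/nbhs_dist[d d0 h]; exists d => // x /h xd.
rewrite /reduced_grad opprD addrACA [X in _ + X]subrr addr0 -mulmxBr.
by rewrite (le_lt_trans (kP _ _))// distrC -ltr_pdivlMl// mulrC.
Qed.

Lemma reduced_grad_unit_surj : reduced_grad x0 \in unitmx <->
  (forall v : 'cV[R]_m, exists w u,
    P *m w = w /\ P *m u = 0 /\ v = grad psi x0 *m w + u).
Proof.
set J := grad psi x0; split=> [uM v|h].
  have [w Mw] : exists w, reduced_grad x0 *m w = P *m v.
    by exists (invmx (reduced_grad x0) *m (P *m v)); rewrite mulKVmx.
  have Pw : P *m w = w.
    apply/compl_eq0; have := congr1 (mulmx (1%:M - P)) Mw.
    rewrite mulmxA mulmxDr !mulmxA compl_proj compl_compl !mul0mx.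
    by rewrite add0r.
  exists w, (v - J *m w); split=> //; split; last by rewrite addrC subrK.
  move: Mw; rewrite mulmxDl (compl_eq0 _).2// addr0 mulmxBr mulmxA => ->.
  exact: subrr.
rewrite -unitmx_tr; apply: unitmx_cV_inj => w Mw.
apply: dotvv_eq0; have [w1 [u [Pw1 [Pu wE]]]] := h (w - J *m ((1%:M - P) *m w)).
have -> : dotv w w = dotv ((reduced_grad x0)^T *m w) (w1 + (1%:M - P) *m w); last first.
  by rewrite Mw dot0v.
rewrite dotv_mulmxl trmxK; congr dotv.
have -> : reduced_grad x0 *m (w1 + (1%:M - P) *m w) =
    P *m (J *m w1 + J *m ((1%:M - P) *m w)) + (1%:M - P) *m w.
  rewrite /reduced_grad mulmxDl -mulmxA !mulmxDr; congr (_ + _).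
  by rewrite (compl_eq0 _).2// add0r mulmxA mulmxBr mulmx1 compl_proj subr0.
have -> : J *m w1 + J *m ((1%:M - P) *m w) = w - u.
  by apply/eqP; rewrite eq_sym subr_eq addrAC -wE subrK.
by rewrite mulmxBr Pu subr0 -mulmxDl addrC subrK mul1mx.
Qed.

Lemma reduced_grad_unit_inj : reduced_grad x0 \in unitmx <->
  (forall w : 'cV[R]_m, P *m ((grad psi x0)^T *m w) = 0 -> P *m w = w -> w = 0).
Proof.
set J := grad psi x0.
have MT : (reduced_grad x0)^T = J^T *m P + (1%:M - P).
  by rewrite /reduced_grad !raddfD/= raddfN/= trmx_mul PT trmx1.
rewrite -unitmx_tr MT; split=> [uM w PJw Pw|h].
  have E : (J^T *m P + (1%:M - P)) *m (w - J^T *m w) = 0.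
    rewrite mulmxDl mulmxBr -!mulmxA Pw PJw mulmx0 subr0 mulmxBr.
    by rewrite (compl_eq0 _).2// sub0r mulmxBl mul1mx PJw subr0 subrr.
  have /subr0_eq wE : w - J^T *m w = 0 by rewrite -(mulKmx uM (w - _)) E mulmx0.
  by rewrite -Pw wE.
apply: unitmx_cV_inj => w; rewrite mulmxDl -mulmxA => E.
have Pw0 : P *m w = 0.
  apply: h; last by rewrite mulmxA PP.
  have := congr1 (mulmx P) E; rewrite mulmx0 mulmxDr !mulmxA.
  by rewrite proj_compl mul0mx addr0 -!mulmxA.
by move: E; rewrite Pw0 mulmx0 add0r mulmxBl Pw0 mul1mx subr0.
Qed.


Section solution_map.
Variable S : 'cV[R]_m -> set 'cV[R]_m.
Variable e : R.
Hypotheses (e_gt0 : 0 < e).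
Hypothesis S_reduced : forall x y : 'cV[R]_m, `|x - x0| < e -> `|y| < e ->
  (S y x <-> reduced_map x = P *m y).

Lemma lip_loc_reduced sigma : lip_loc S x0 sigma ->
  exists d L : R, [/\ 0 < d, 0 < L, sigma 0 = x0,
    forall y1 y2, `|y1| < d -> `|y2| < d ->
      `|sigma y1 - sigma y2| <= L * `|y1 - y2| &
    forall y, `|y| < d -> reduced_map (sigma y) = P *m y].
Proof.
move=> [U [W [nU [/nbhs_dist[d d0 dW] [US [L hL]]]]]].
have Wd y : `|y| < d -> W y by move=> yd; apply: dW; rewrite subr0.
have W0 : W 0 by apply: Wd; rewrite normr0.
have s0 : sigma 0 = x0.
  apply/esym/(US _ W0); split; first exact: nbhs_singleton.
  by apply/S_reduced; rewrite ?subrr ?normr0// reduced_map0 mulmx0.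
pose L' := `|L| + 1; have L'0 : 0 < L' by rewrite ltr_wpDl.
have lip y1 y2 : W y1 -> W y2 -> `|sigma y1 - sigma y2| <= L' * `|y1 - y2|.
  move=> W1 W2; rewrite (le_trans (hL _ _ W1 W2))// ler_wpM2r//.
  by rewrite (le_trans (ler_norm L))// lerDl.
pose d' := Num.min d (Num.min e (L'^-1 * e)).
have d'd y : `|y| < d' -> [/\ `|y| < d, `|y| < e & `|y| < L'^-1 * e].
  by rewrite !lt_min => /andP[-> /andP[-> ->]].
exists d', L'; split=> // [|y1 y2 /d'd[/Wd W1 _ _] /d'd[/Wd W2 _ _]|y].
- by rewrite !lt_min d0 e_gt0 mulr_gt0// invr_gt0.
- exact: lip.
move=> /d'd[/Wd Wy ye yL]; apply/(S_reduced _ ye); last first.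
  by have [] := (US y Wy (sigma y)).2 erefl.
have := lip y 0 Wy W0; rewrite s0 subr0 => /le_lt_trans; apply.
by rewrite -ltr_pdivlMl.
Qed.

Lemma lip_loc_unit sigma : lip_loc S x0 sigma -> reduced_grad x0 \in unitmx.
Proof.
move=> /lip_loc_reduced[d [L [d0 L0 s0 lip sol]]].
apply/reduced_grad_unit_inj => u PJu Pu; apply: dotvv_eq0; apply: le_anti.
have uu0 : 0 <= dotv u u.
  by rewrite dotvE; apply: sumr_ge0 => i _; rewrite -expr2 sqr_ge0.
rewrite uu0 andbT; apply/ler_addgt0Pr => f f0; rewrite add0r.
pose C := m%:R * `|u| * L * `|u| + 1.
have C0 : 0 < C by rewrite ltr_wpDl// !mulr_ge0// ltW.
have [|d1 d10 h] := @reduced_map_strict x0 (f / C); first by rewrite divr_gt0.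
pose q := Num.min d (L^-1 * d1); pose t := q / (`|u| + 1).
have u1 : 0 < `|u| + 1 by rewrite ltr_wpDl.
have q0 : 0 < q by rewrite lt_min d0 mulr_gt0// invr_gt0.
have t0 : 0 < t by rewrite divr_gt0.
have tuq : `|t *: u| < q.
  rewrite normrZ gtr0_norm// /t -mulrA gtr_pMr// mulrC ltr_pdivrMr// mul1r.
  by rewrite ltrDl.
have tud : `|t *: u| < d by rewrite (lt_le_trans tuq)// ge_min lexx.
have tud1 : `|t *: u| < L^-1 * d1.
  by rewrite (lt_le_trans tuq)// ge_min lexx orbT.
have d0' : `|0 : 'cV[R]_m| < d by rewrite normr0.
have xt := lip _ _ tud d0'; rewrite s0 subr0 in xt.
have Gx := sol _ tud; set x := sigma (t *: u) in xt Gx.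
have xd1 : `|x - x0| < d1.
  by apply: le_lt_trans xt _; rewrite -ltr_pdivlMl.
rewrite normrZ gtr0_norm// in xt.
have [Px _] := (reduced_mapE _ _).1 Gx.
have := h x x0 xd1; rewrite subrr normr0 => /(_ d10).
rewrite reduced_map0 subr0 Gx -scalemxAr Pu => hx.
have := le_trans (ler_norm _) (dotv_norm u (t *: u - reduced_grad x0 *m (x - x0))).
have -> : dotv u (t *: u - reduced_grad x0 *m (x - x0)) = t * dotv u u.
  rewrite dotvDr dotvNr dotvZr /reduced_grad mulmxDl (compl_eq0 _).2// addr0.
  rewrite -(dotvC (_ *m (x - x0))) dotv_mulmxl trmx_mul PT -mulmxA Pu dotvC.
  by rewrite -Px -{1}PT -dotv_mulmxl PJu dot0v subr0.
move=> h1; rewrite -(ler_pM2l t0); apply: le_trans h1 _.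
have fC0 : 0 <= f / C by rewrite divr_ge0// ltW.
have h2 : m%:R * `|u| * `|t *: u - reduced_grad x0 *m (x - x0)| <=
    m%:R * `|u| * (f / C * (L * (t * `|u|))).
  apply: ler_wpM2l; first by rewrite mulr_ge0.
  by apply: le_trans hx _; apply: ler_wpM2l.
apply: le_trans h2 _.
have -> : m%:R * `|u| * (f / C * (L * (t * `|u|))) =
    t * (f * ((m%:R * `|u| * L * `|u|) / C)) by ring.
rewrite ler_pM2l// ger_pMr// ler_pdivrMr// mul1r /C.
by rewrite lerDl.
Qed.

Lemma unit_lip_loc : reduced_grad x0 \in unitmx ->
  exists sigma, lip_loc S x0 sigma.
Proof.
move=> uM; have [k k0 kP] := mulmx_lipschitz P.
have [r0 [L [r00 L0 inj sur]]] := strict_local_inverse uM (@reduced_map_strict x0).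
pose r := Num.min r0 (e / 2).
have rr0 : r <= r0 by rewrite ge_min lexx.
have re : r < e.
  have : r <= e / 2 by rewrite ge_min lexx orbT.
  by move: e_gt0; lra.
have r_gt0 : 0 < r by rewrite lt_min r00 divr_gt0.
have [|s s0 {}sur] := sur r; first by rewrite r_gt0.
pose sigma y := get [set x : 'cV[R]_m | `|x - x0| <= r /\ reduced_map x = P *m y].
pose W := [set y : 'cV[R]_m | `|y| < e /\ `|y| < k^-1 * s].
have sigmaP y : W y -> `|sigma y - x0| <= r /\ reduced_map (sigma y) = P *m y.
  move=> [ye ys]; have [|x xr Gx] := sur (P *m y).
    by rewrite reduced_map0 subr0 (le_lt_trans (kP _ _))// -ltr_pdivlMl.
  apply: (@getPex _ [set x | `|x - x0| <= r /\ reduced_map x = P *m y]).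
  by exists x.
exists sigma, [set x | `|x - x0| <= r], W; split; [|split; [|split]].
- by apply/nbhs_dist; exists r => // x; exact: ltW.
- apply/nbhs_dist; exists (Num.min e (k^-1 * s)).
    by rewrite lt_min e_gt0 mulr_gt0// invr_gt0.
  by move=> y; rewrite subr0 lt_min => /andP[].
- move=> y Wy x; have [sr sG] := sigmaP y Wy.
  have redS z : `|z - x0| <= r -> S y z <-> reduced_map z = P *m y.
    by move=> zr; apply: S_reduced; [exact: le_lt_trans re|exact: Wy.1].
  split=> [[/= xr /(redS _ xr) xG]|->]; last by split=> //; apply/redS.
  apply/subr0_eq/normr0_eq0/le_anti; rewrite normr_ge0 andbT.
  rewrite (le_trans (inj _ _ (le_trans xr rr0) (le_trans sr rr0)))//.
  by rewrite xG sG subrr normr0 mulr0.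
exists (L * k) => y1 y2 /sigmaP[s1 G1] /sigmaP[s2 G2].
rewrite (le_trans (inj _ _ (le_trans s1 rr0) (le_trans s2 rr0)))// -mulrA.
by rewrite ler_wpM2l ?(ltW L0)// G1 G2 -mulmxBr kP.
Qed.

Lemma lip_loc_C1 sigma : lip_loc S x0 sigma ->
  exists2 d : R, 0 < d & forall y : 'cV[R]_m, `|y| < d ->
    [/\ reduced_grad (sigma y) \in unitmx, differentiable sigma y,
      reduced_grad (sigma y) *m grad sigma y = P &
      {for y, continuous (grad sigma)}].
Proof.
move=> ll; have uM := lip_loc_unit ll.
have [d [L [d0 L0 s0 lip sol]]] := lip_loc_reduced ll.
have [dp [cp [dp0 _ pert]]] := unitmx_perturbation uM.
have [dc dc0 cont] := @reduced_grad_continuous x0 _ dp0.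
pose d' := Num.min d (L^-1 * dc).
have d'd (y : 'cV[R]_m) : `|y| < d' -> `|y| < d /\ `|y| < L^-1 * dc.
  by rewrite lt_min => /andP[].
have U y : `|y| < d' -> reduced_grad (sigma y) \in unitmx.
  move=> /d'd[yd ydc]; apply: (pert _ _).1; apply: cont.
  have := lip y 0 yd; rewrite normr0 s0 subr0 => /(_ d0)/le_lt_trans; apply.
  by rewrite -ltr_pdivlMl.
have near_y (y : 'cV[R]_m) f : `|y| < d' -> 0 < f -> exists2 r, 0 < r &
    forall z : 'cV[R]_m, `|z - y| < r -> `|z| < d' /\ `|sigma z - sigma y| < f.
  move=> yd f0; exists (Num.min (d' - `|y|) (L^-1 * f)).
    by rewrite lt_min subr_gt0 yd mulr_gt0// invr_gt0.
  move=> z; rewrite lt_min => /andP[zd zf].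
  have zd' : `|z| < d' by have := ler_normD (z - y) y; rewrite subrK; lra.
  split=> //; have /le_lt_trans := lip _ _ (d'd _ zd').1 (d'd _ yd).1; apply.
  by rewrite -ltr_pdivlMl.
have D y : `|y| < d' -> differentiable sigma y /\
    grad sigma y = invmx (reduced_grad (sigma y)) *m P.
  move=> yd; have uMy := U y yd; set M := reduced_grad (sigma y) in uMy *.
  have [k k0 kN] := mulmx_lipschitz (invmx M).
  apply: dist_differentiable => f f0.
  have [|d1 d10 h] := @reduced_map_strict (sigma y) (f / (k * L)).
    by rewrite divr_gt0// mulr_gt0.
  have [r r0 hr] := near_y y d1 yd d10; exists r => // z /hr[zd zy].
  have -> : sigma z - sigma y - invmx M *m P *m (z - y) = - (invmx M *m
      (reduced_map (sigma z) - reduced_map (sigma y) - M *m (sigma z - sigma y))).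
    rewrite [invmx M *m (_ - _)]mulmxBr mulKmx// (sol _ (d'd _ zd).1).
    by rewrite (sol _ (d'd _ yd).1) -mulmxBr opprB mulmxA.
  rewrite normrN (le_trans (kN _ _))//.
  have hz : `|sigma y - sigma y| < d1 by rewrite subrr normr0.
  rewrite -ler_pdivlMl//; apply: le_trans (h _ _ zy hz) _.
  have -> : k^-1 * (f * `|z - y|) = f / (k * L) * (L * `|z - y|).
    by field; rewrite !gt_eqF.
  apply: ler_wpM2l; first by rewrite divr_ge0 ?mulr_ge0 ?(ltW f0) ?(ltW k0) ?(ltW L0).
  exact: lip (d'd _ zd).1 (d'd _ yd).1.
exists d' => [|y yd]; first by rewrite lt_min d0 mulr_gt0// invr_gt0.
have [dy gy] := D y yd; have eq_grad z : `|z| < d' ->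
    reduced_grad (sigma z) *m grad sigma z = P.
  by move=> zd; rewrite (D z zd).2 mulKVmx ?U.
split; [exact: U | by [] | exact: eq_grad |].
apply: dist_continuous => f f0.
have [dq [c [dq0 c0 pert_y]]] := unitmx_perturbation (U y yd).
pose q := c * (`|grad sigma y| + 1).
have q0 : 0 < q by rewrite mulr_gt0// ltr_wpDl.
have [|dm dm0 cont_y] := @reduced_grad_continuous (sigma y) (Num.min dq (f / q)).
  by rewrite lt_min dq0 divr_gt0.
have [r r0 hr] := near_y y dm yd dm0; exists r => // z /hr[zd /cont_y].
rewrite lt_min => /andP[/pert_y[_ hX] hf].
have {}hX := hX m (grad sigma z) (grad sigma y)
  (etrans (eq_grad z zd) (esym (eq_grad y yd))).
apply: (le_lt_trans hX).
rewrite ltr_pdivlMr// /q mulrCA mulrA mulrDr mulr1 in hf.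
by apply: le_lt_trans hf; rewrite lerDl mulr_ge0// ltW.
Qed.

End solution_map.

Lemma reduced_grad_inverse x s (B : 'M[R]_(m, s)) (X : 'M[R]_m) :
  row_free B^T -> (forall w : 'cV[R]_m, P *m w = w <-> exists c, w = B *m c) ->
  reduced_grad x \in unitmx -> reduced_grad x *m X = P ->
  (B^T *m grad psi x *m B) \in unitmx /\
  X = B *m invmx (B^T *m grad psi x *m B) *m B^T.
Proof.
move=> fB PB uM MX; set A := B^T *m grad psi x *m B.
have PBc (c : 'cV[R]_s) : P *m (B *m c) = B *m c by apply/PB; exists c.
have Bt0 (v : 'cV[R]_m) : B^T *m v = 0 -> P *m v = 0.
  move=> Bv; apply: dotvv_eq0; have [|c Pv] := (PB (P *m v)).1.
    by rewrite mulmxA PP.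
  by rewrite {2}Pv dotv_mulmxl PT PBc dotvC dotv_mulmxl Bv dotv0.
have MB (c : 'cV[R]_s) : reduced_grad x *m (B *m c) = P *m (grad psi x *m (B *m c)).
  by rewrite /reduced_grad mulmxDl (compl_eq0 _).2// addr0 -mulmxA.
have uA : A \in unitmx.
  apply: unitmx_cV_inj => c; rewrite /A -!mulmxA => /Bt0 PJB.
  have Bc0 : B *m c = 0 by rewrite -(mulKmx uM (B *m c)) MB PJB mulmx0.
  apply: trmx_inj; apply/eqP.
  by rewrite trmx0 -(mulmx_free_eq0 _ fB) -trmx_mul Bc0 trmx0.
split=> //; rewrite -(mulKmx uM X) MX; apply: eq_mulmx_cV => v.
apply: (can_inj (mulKmx uM)); rewrite mulmxA mulKVmx// -!mulmxA MB.
apply/subr0_eq; rewrite -mulmxBr; apply: Bt0.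
have -> : B^T *m (v - grad psi x *m (B *m (invmx A *m (B^T *m v)))) =
    B^T *m v - A *m (invmx A *m (B^T *m v)) by rewrite mulmxBr /A !mulmxA.
by rewrite mulKVmx// subrr.
Qed.

End reduced_equation.

Lemma perp_projector (R : realType) m (K : set 'cV[R]_m) (P : 'M[R]_m) u :
  P^T = P -> P *m P = P -> (forall w, K w <-> P *m w = w) ->
  perp K u <-> P *m u = 0.
Proof.
move=> PT PP KP; split=> [Ku|Pu w /KP <-].
  apply: dotvv_eq0; rewrite dotv_mulmxl PT; apply: Ku.
  by apply/KP; rewrite !mulmxA PP PP.
by rewrite -{1}PT -dotv_mulmxl Pu dot0v.
Qed.

Unset Implicit Arguments.

Theorem theorem5p4 (R : realType) (m : nat) (psi : 'cV[R]_m -> 'cV[R]_m)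
  (g : 'cV[R]_m -> \bar R) (xbar : 'cV[R]_m) :
  C1 psi -> polyhedral_fun g -> ri (subdiff g xbar) (- psi xbar) ->
  let Kb := crit_cone g xbar (- psi xbar) in
  let J := grad psi xbar in
  let conda := forall v : 'cV[R]_m, exists w u, Kb w /\ perp Kb u /\ v = J *m w + u in
  let condb := forall w, perp Kb (J^T *m w) -> Kb w -> w = 0 in
  (conda <-> condb) /\
  ((exists sigma, lip_loc (solmap psi g) xbar sigma) <-> conda) /\
  (forall sigma, lip_loc (solmap psi g) xbar sigma ->
     (exists W : set 'cV[R]_m, open W /\ W 0 /\
        forall y, W y -> differentiable sigma y /\ {for y, continuous (grad sigma)}) /\
     (forall s (B : 'M[R]_(m, s)), cols_basis_of B Kb ->
        exists W : set 'cV[R]_m, nbhs (0 : 'cV[R]_m) W /\ forall y, W y ->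
          (B^T *m grad psi (sigma y) *m B) \in unitmx /\
          grad sigma y = B *m invmx (B^T *m grad psi (sigma y) *m B) *m B^T)).
Proof.
move=> psiC1 pg ril Kb J conda condb.
have [P [PT PP KP [r r0 red]]] := polyhedral_reduction pg ril.
have perpP u : perp Kb u <-> P *m u = 0 := perp_projector u PT PP KP.
have ucond_a : reduced_grad psi P xbar \in unitmx <-> conda.
  rewrite reduced_grad_unit_surj//; split=> h v; have [w [u [Kw [Ku ->]]]] := h v;
    by exists w, u; split; [apply/KP|split; [apply/perpP|]].
have ucond_b : reduced_grad psi P xbar \in unitmx <-> condb.
  rewrite reduced_grad_unit_inj//; split=> h w Kw Pw.
    by apply: h; [apply/perpP|apply/KP].
  by apply: h; [apply/perpP|apply/KP].
have /differentiable_continuous/cvgrPdist_lt/(_ (r / 2)) := psiC1.1 xbar.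
rewrite divr_gt0// => /(_ isT)/nbhs_dist[d d0 psi_d].
pose e := Num.min d (Num.min r (r / 2)).
have e0 : 0 < e by rewrite !lt_min d0 r0 divr_gt0.
have red_map (x y : 'cV[R]_m) : `|x - xbar| < e -> `|y| < e ->
    solmap psi g y x <-> reduced_map psi xbar P x = P *m y.
  rewrite !lt_min => /andP[/psi_d xd /andP[xr _]] /andP[_ /andP[_ yr]].
  rewrite reduced_mapE//; apply: red => //.
  have -> : y - psi x - - psi xbar = y + (psi xbar - psi x).
    by rewrite opprK addrAC addrA.
  by rewrite (le_lt_trans (ler_normD _ _))//; lra.
split; first by rewrite -ucond_a ucond_b.
split.
  rewrite -ucond_a; split=> [[sigma]|].
    exact: (lip_loc_unit psiC1 PT PP e0 red_map).
  exact: (unit_lip_loc psiC1 e0 red_map).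
move=> sigma /(lip_loc_C1 psiC1 PT PP e0 red_map)[f f0 sol]; split.
  exists [set y | `|y| < f]; split; last split.
  - rewrite (_ : mkset _ = ball (0 : 'cV[R]_m) f); first exact: ball_open.
    by rewrite -ball_normE; apply/funext => y; rewrite /ball_ /= sub0r normrN.
  - by rewrite /= normr0.
  - by move=> y /sol[].
move=> s B [fB BK]; exists [set y | `|y| < f]; split.
  by apply/nbhs_dist; exists f => // y; rewrite subr0.
move=> y /sol[uM _ MX _]; apply: (reduced_grad_inverse PT PP fB _ uM MX) => w.
by rewrite -BK; split=> /KP.
Qed.
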